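(* Let $X$ be a Banach space, let $T \in L(X)$ and let $F \in L(X)$ be a finite rank operator. If $T$ is a left (resp. right) semi-B-Fredholm operator, then $T + F$ is a left (resp. right) semi-B-Fredholm operator.
   Context: $L(X)$ is the Banach algebra of bounded linear operators on the Banach space $X$, $F_0(X)$ is the ideal of finite rank operators in $L(X)$, $\mathcal{C}_0(X) = L(X)/F_0(X)$ is the (purely algebraic) quotient algebra, and $\pi : L(X) \to \mathcal{C}_0(X)$ is the natural projection. Let $A$ be a ring with unit, and for $p \in A$ let $comm(p) = \{x \in A : xp = px\}$. For an idempotent $p \in A$, an element $a \in A$ is called left (resp. right) $p$-invertible if $ap = pa$ and $a + p$ is left (resp. right) invertible in $comm(p)$ (i.e. has a left (resp. right) inverse belonging to $comm(p)$). An element $a \in A$ is called left (resp. right) Drazin invertible if there exists an idempotent $p \in A$ such that $a$ is left (resp. right) $p$-invertible and $ap$ is nilpotent. $T \in L(X)$ is called a left (resp. right) semi-B-Fredholm operator if $\pi(T)$ is left (resp. right) Drazin invertible in $\mathcal{C}_0(X)$. *)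

(* Defs.v *)
From HB Require Import structures.
From mathcomp Require Import all_boot all_order all_algebra.
From mathcomp Require Import all_classical all_reals all_analysis.

Set Implicit Arguments.
Unset Strict Implicit.
Unset Printing Implicit Defensive.

Import Order.TTheory GRing.Theory Num.Theory.
Import numFieldNormedType.Exports.

Local Open Scope classical_set_scope.
Local Open Scope ring_scope.
Local Open Scope quotient_scope.

Section LeftRightDrazin.
Variable A : pzRingType.
Implicit Types p a x : A.

Definition comm p : set A := [set x | x * p = p * x].

Definition left_invertible_in (S : set A) x : Prop :=
  S x /\ exists2 y, S y & y * x = 1.

Definition right_invertible_in (S : set A) x : Prop :=
  S x /\ exists2 y, S y & x * y = 1.

Definition left_p_invertible p a : Prop :=
  a * p = p * a /\ left_invertible_in (comm p) (a + p).

Definition right_p_invertible p a : Prop :=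
  a * p = p * a /\ right_invertible_in (comm p) (a + p).

(* allowing n = 0 is harmless: x ^+ 0 = 0 forces the ring to be trivial *)
Definition nilpotent_elt x : Prop := exists n : nat, x ^+ n = 0.

Definition left_Drazin_invertible a : Prop :=
  exists p, [/\ p * p = p, left_p_invertible p a & nilpotent_elt (a * p)].

Definition right_Drazin_invertible a : Prop :=
  exists p, [/\ p * p = p, right_p_invertible p a & nilpotent_elt (a * p)].

End LeftRightDrazin.

(* For R : realType, the scalar fields K := R and K := R[i] give real and
   complex Banach spaces. *)
Section BoundedOperators.
Variables (K : numFieldType) (X : normedModType K).

Definition bounded_operator (f : X -> X) : Prop :=
  exists M : K, forall x, `|f x| <= M * `|x|.

Definition bounded_linear_pred : {pred X -> X} :=
  [pred f : X -> X | `[< linear f /\ bounded_operator f >]].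

Lemma bounded_linear_zmod_closed : zmod_closed bounded_linear_pred.
Proof.
split.
  apply/asboolP; split; first by move=> a x y; rewrite scaler0 addr0.
  by exists 0 => x; rewrite normr0 mul0r.
move=> f g /asboolP[lf [M fM]] /asboolP[lg [N gN]]; apply/asboolP; split.
  move=> a x y; change (f (a *: x + y) - g (a *: x + y) =
    a *: (f x - g x) + (f y - g y)).
  by rewrite lf lg scalerBr opprD addrACA.
exists (M + N) => x; change (`|f x - g x| <= (M + N) * `|x|).
by rewrite mulrDl (le_trans (ler_normB _ _))// lerD.
Qed.

HB.instance Definition _ :=
  GRing.isZmodClosed.Build (X -> X) bounded_linear_pred
    bounded_linear_zmod_closed.

(* L(X) *)
Record bounded_op := BoundedOp {
  op_fun :> X -> X;
  op_funP : op_fun \in bounded_linear_pred }.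

HB.instance Definition _ := [isSub for op_fun].
HB.instance Definition _ := [Choice of bounded_op by <:].
HB.instance Definition _ := [SubChoice_isSubZmodule of bounded_op by <:].

Implicit Types S T U : bounded_op.

Lemma op_eq S T : (S : X -> X) =1 T -> S = T.
Proof. by move=> ST; apply/val_inj/funext. Qed.

Lemma op_linear T : linear T.
Proof. by have /asboolP[] := op_funP T. Qed.

Lemma op_bounded T : bounded_operator T.
Proof. by have /asboolP[] := op_funP T. Qed.

Lemma op_addv T x y : T (x + y) = T x + T y.
Proof. by have := op_linear T 1 x y; rewrite !scale1r. Qed.

Lemma op_zerov T : T 0 = 0.
Proof. by apply: (@addIr _ (T 0)); rewrite -op_addv !add0r. Qed.

Lemma op_scalev T a x : T (a *: x) = a *: T x.
Proof. by have := op_linear T a x 0; rewrite op_zerov !addr0. Qed.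

Lemma op_sumv T n (v : 'I_n -> X) : T (\sum_i v i) = \sum_i T (v i).
Proof. exact: (big_morph _ (op_addv T) (op_zerov T)). Qed.

Lemma id_bounded_linear : @idfun X \in bounded_linear_pred.
Proof. by apply/asboolP; split=> //; exists 1 => x; rewrite mul1r. Qed.

Lemma comp_bounded_linear S T :
  (S : X -> X) \o (T : X -> X) \in bounded_linear_pred.
Proof.
apply/asboolP; split; first by move=> a x y; rewrite /= !op_linear.
have [M SM] := op_bounded S; have [N TN] := op_bounded T.
have [x0 [xn0|xall]] : exists x0 : X, x0 != 0 \/ forall x : X, x = 0.
  have [[x xn0]|nx] := pselect (exists x : X, x != 0); first by exists x; left.
  exists 0; right=> x; apply/eqP; apply: contrapT => /negP xn0.
  by apply: nx; exists x.
- have M0 : 0 <= M.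
    have := le_trans (normr_ge0 _) (SM x0).
    by rewrite pmulr_lge0 // normr_gt0.
  exists (M * N) => x /=; rewrite -mulrA.
  by apply: le_trans (SM _) _; rewrite ler_wpM2l.
- by exists 0 => x; rewrite [X in `|X|]xall normr0 mul0r.
Qed.

Definition op_one : bounded_op := BoundedOp id_bounded_linear.
Definition op_mul S T : bounded_op := BoundedOp (comp_bounded_linear S T).

Fact op_mulA : associative op_mul. Proof. by move=> S T U; exact: op_eq. Qed.
Fact op_mul1l : left_id op_one op_mul. Proof. by move=> T; exact: op_eq. Qed.
Fact op_mul1r : right_id op_one op_mul. Proof. by move=> T; exact: op_eq. Qed.
Fact op_mulDl : left_distributive op_mul +%R.
Proof. by move=> S T U; exact: op_eq. Qed.
Fact op_mulDr : right_distributive op_mul +%R.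
Proof. by move=> S T U; apply: op_eq => x; exact: op_addv. Qed.

(* possibly trivial, since X may be the zero space *)
HB.instance Definition _ := GRing.Zmodule_isPzRing.Build bounded_op
  op_mulA op_mul1l op_mul1r op_mulDl op_mulDr.

Definition lin_span n (v : 'I_n -> X) : set X :=
  [set \sum_i c i *: v i | c in [set: 'I_n -> K]].

Definition finite_dimensional (W : set X) : Prop :=
  exists n (v : 'I_n -> X), W = lin_span v.

Definition finite_rank T : Prop := finite_dimensional (range T).

Definition subspace (W : set X) : Prop :=
  W 0 /\ forall a x y, W x -> W y -> W (a *: x + y).

Lemma range_subspace T : subspace (range T).
Proof.
split; first by exists 0; rewrite ?op_zerov.
by move=> a _ _ [x _ <-] [y _ <-]; exists (a *: x + y); rewrite ?op_linear.
Qed.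

Lemma subspace_finite_dimensional n (v : 'I_n -> X) (W : set X) :
  subspace W -> W `<=` lin_span v -> finite_dimensional W.
Proof.
elim: n v W => [|n IHn] v W [W0 Wlin] Wv.
  exists 0, v; apply/seteqP; split=> // x [c _ <-]; by rewrite big_ord0.
pose v' i := v (lift ord0 i).
have [V0 Vlin] : subspace (W `&` lin_span v').
  split.
    split=> //; exists (fun=> 0) => //.
    by apply: big1 => i _; rewrite scale0r.
  move=> a x y [Wx [c _ cx]] [Wy [d _ dy]]; split; first exact: Wlin.
  exists (fun i => a * c i + d i) => //.
  rewrite -cx -dy scaler_sumr -big_split /=.
  by apply: eq_bigr => i _; rewrite scalerDl scalerA.
have [m [u Wu]] := IHn v' _ (conj V0 Vlin) (@subIsetr _ _ _).
have [[w [Ww [c cw cn0]]]|noc] := pselect (exists w, W w /\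
    exists2 c : 'I_n.+1 -> K, \sum_i c i *: v i = w & c ord0 != 0).
  exists m.+1, (fun i => oapp u w (unlift ord0 i)).
  apply/seteqP; split=> x.
    move=> Wx; have [d _ dx] := Wv _ Wx.
    have : (W `&` lin_span v') (- (d ord0 / c ord0) *: w + x).
      split; first exact: Wlin.
      exists (fun i => - (d ord0 / c ord0) * c (lift ord0 i) + d (lift ord0 i)) => //.
      rewrite -cw -dx scaler_sumr -big_split big_ord_recl /=.
      rewrite scalerA mulNr divfK // scaleNr addNr add0r.
      by apply: eq_bigr => i _; rewrite scalerDl scalerA.
    rewrite Wu => -[e _ ex].
    exists (fun i => oapp e (d ord0 / c ord0) (unlift ord0 i)) => //.
    rewrite big_ord_recl unlift_none /=.
    under eq_bigr => i _ do rewrite liftK /=.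
    by rewrite ex addrA scaleNr subrr add0r.
  move=> [e _ <-]; rewrite big_ord_recl unlift_none /=; apply: Wlin => //.
  under eq_bigr => i _ do rewrite liftK /=.
  suff : (W `&` lin_span v') (\sum_i e (lift ord0 i) *: u i) by case.
  by rewrite Wu; exists (fun i => e (lift ord0 i)).
exists m, u; rewrite -Wu; apply/seteqP; split=> [x Wx|x []//].
split=> //; have [d _ dx] := Wv _ Wx.
have d0 : d ord0 = 0.
  apply/eqP; apply: contrapT => /negP dn0; apply: noc.
  by exists x; split=> //; exists d.
exists (fun i => d (lift ord0 i)) => //.
by rewrite -dx big_ord_recl d0 scale0r add0r.
Qed.

Lemma finite_rank_sub T n (v : 'I_n -> X) :
  (forall x, lin_span v (T x)) -> finite_rank T.
Proof.
move=> Tv; apply: (@subspace_finite_dimensional _ v).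
  exact: range_subspace.
by move=> _ [x _ <-].
Qed.

Lemma finite_rank_span T : finite_rank T ->
  exists n (v : 'I_n -> X), forall x, lin_span v (T x).
Proof. by move=> [n [v Tv]]; exists n, v => x; rewrite -Tv; exists x. Qed.

Definition finite_rank_pred : {pred bounded_op} :=
  [pred T : bounded_op | `[< finite_rank T >]].

Lemma finite_rank_zmod_closed : zmod_closed finite_rank_pred.
Proof.
split.
  apply/asboolP/(@finite_rank_sub _ 0 (fun=> 0)) => x.
  by exists (fun=> 0); rewrite ?big_ord0.
move=> S T /asboolP/finite_rank_span[n [v Sv]].
move=> /asboolP/finite_rank_span[m [u Tu]].
apply/asboolP/(@finite_rank_sub _ (n + m)
  (fun i => match fintype.split i with inl j => v j | inr k => u k end)) => x.
have [c _ cx] := Sv x; have [d _ dx] := Tu x.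
exists (fun i => match fintype.split i with inl j => c j | inr k => - d k end) => //.
change (\sum_i (match fintype.split i with inl j => c j | inr k => - d k end) *:
  (match fintype.split i with inl j => v j | inr k => u k end) = S x - T x).
rewrite big_split_ord /= -cx -dx -sumrN; congr (_ + _).
  by apply: eq_bigr => i _; rewrite (unsplitK (inl i)).
by apply: eq_bigr => i _; rewrite (unsplitK (inr i)) scaleNr.
Qed.

HB.instance Definition _ :=
  GRing.isZmodClosed.Build bounded_op finite_rank_pred finite_rank_zmod_closed.

Lemma finite_rank_mull S T : T \in finite_rank_pred -> S * T \in finite_rank_pred.
Proof.
move=> /asboolP/finite_rank_span[n [v Tv]].
apply/asboolP/(@finite_rank_sub _ n (fun i => S (v i))) => x.
have [c _ cx] := Tv x; exists c => //.
change (\sum_i c i *: S (v i) = S (T x)).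
by rewrite -cx op_sumv; apply: eq_bigr => i _; rewrite op_scalev.
Qed.

Lemma finite_rank_mulr S T : S \in finite_rank_pred -> S * T \in finite_rank_pred.
Proof.
move=> /asboolP/finite_rank_span[n [v Sv]].
by apply/asboolP/(@finite_rank_sub _ n v) => x; exact: Sv (T x).
Qed.

(* C_0(X) = L(X) / F_0(X).  The library provides the quotient of an additive
   group by a subgroup; it equips it with a product only for commutative
   rings, so the ring structure is built here. *)
Definition C0 := Quotient.quot finite_rank_pred.

HB.instance Definition _ := EqQuotient.on C0.
HB.instance Definition _ := GRing.Zmodule.on C0.

Definition C0_one : C0 := lift_cst C0 1.
Definition C0_mul : C0 -> C0 -> C0 := lift_op2 C0 *%R.

Canonical pi_C0_one_morph := PiConst C0_one.

Lemma pi_C0_mul : {morph \pi_C0 : S T / S * T >-> C0_mul S T}.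
Proof.
move=> S T; unlock C0_mul; apply/eqP; rewrite piE Quotient.equivE.
rewrite -[S * T](addrNK (S * repr (\pi_C0 T))) -mulrBr -addrA -mulrBl.
rewrite rpredD //.
  by rewrite finite_rank_mull // Quotient.idealrBE reprK.
by rewrite finite_rank_mulr // Quotient.idealrBE reprK.
Qed.
Canonical pi_C0_mul_morph := PiMorph2 pi_C0_mul.

Fact C0_mulA : associative C0_mul.
Proof. by move=> x y z; rewrite -[x]reprK -[y]reprK -[z]reprK !piE mulrA. Qed.
Fact C0_mul1l : left_id C0_one C0_mul.
Proof. by move=> x; rewrite -[x]reprK !piE mul1r. Qed.
Fact C0_mul1r : right_id C0_one C0_mul.
Proof. by move=> x; rewrite -[x]reprK !piE mulr1. Qed.
Fact C0_mulDl : left_distributive C0_mul +%R.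
Proof.
by move=> x y z; rewrite -[x]reprK -[y]reprK -[z]reprK !piE mulrDl.
Qed.
Fact C0_mulDr : right_distributive C0_mul +%R.
Proof.
by move=> x y z; rewrite -[x]reprK -[y]reprK -[z]reprK !piE mulrDr.
Qed.

HB.instance Definition _ := GRing.Zmodule_isPzRing.Build C0
  C0_mulA C0_mul1l C0_mul1r C0_mulDl C0_mulDr.

Definition left_semi_B_Fredholm T : Prop :=
  left_Drazin_invertible (\pi_C0 T : C0).

Definition right_semi_B_Fredholm T : Prop :=
  right_Drazin_invertible (\pi_C0 T : C0).

End BoundedOperators.

Arguments bounded_op {K} X.
Arguments C0 {K} X.

(* Main.v *)
Require Import Defs.
From mathcomp Require Import all_boot all_order all_algebra.
From mathcomp Require Import all_classical all_reals all_analysis.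

Import GRing.Theory.
Local Open Scope ring_scope.

(** Both semi-B-Fredholm properties depend on the operator only through its
    class modulo the finite rank operators, and adding a finite rank operator
    does not change that class. *)
Lemma pi_C0_add_finite_rank (K : numFieldType) (X : normedModType K)
    (T F : bounded_op X) :
  finite_rank F -> (\pi_(C0 X) (T + F) = \pi_(C0 X) T)%qT.
Proof.
move=> frF; apply/eqP; rewrite piE Quotient.equivE addrAC subrr add0r.
exact/asboolP.
Qed.

Theorem mainTheorem4 (K : numFieldType) (X : completeNormedModType K)
    (T F : bounded_op X) (F_finite_rank : finite_rank F) :
  (left_semi_B_Fredholm T -> left_semi_B_Fredholm (T + F)) /\
  (right_semi_B_Fredholm T -> right_semi_B_Fredholm (T + F)).
Proof.
by rewrite /left_semi_B_Fredholm /right_semi_B_Fredholm pi_C0_add_finite_rank.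
Qed.
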